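(* Let $\Omega=\{(x,y)\in\mathbb{R}^2 : x>0\}$ and let $\varphi:\Omega\to\mathbb{R}^2_+$ be the map $$\varphi(x,y)=\left(\frac{e^{x}\sqrt{1+e^{y}}}{e^{x}+e^{y}},\ \frac{e^{y}\sqrt{e^{x}-1}}{e^{x}+e^{y}}\right).$$ Then $\varphi$ is surjective, and it maps the lines $x=\mathrm{const}$ in $\Omega$ to arcs of circles of the elliptic Apollonian pencil of $F_1,F_2$, the rays $y=\mathrm{const}$ in $\Omega$ to arcs of circles of the hyperbolic Apollonian pencil of $F_1,F_2$, and the rays $x-y=\mathrm{const}$ in $\Omega$ to arcs of hyperbolas with foci $F_1$ and $F_2$.
   Context: $\mathbb{R}^2_+=\{(s,t)\in\mathbb{R}^2: s>0,\ t>0\}$ is the (open) positive quadrant. The foci are $F_1=(-1,0)$ and $F_2=(1,0)$. The elliptic Apollonian pencil of $F_1,F_2$ is the family of circles passing through both $F_1$ and $F_2$. The hyperbolic Apollonian pencil of $F_1,F_2$ is the family of circles orthogonal to all circles of the elliptic pencil; each of its circles is a locus of points $X$ with $|XF_1|/|XF_2|=\mathrm{const}$. A branch of a hyperbola with foci $F_1,F_2$ is a locus $|XF_1|-|XF_2|=\mathrm{const}$ (in $\mathbb{R}^2_+$ this difference lies in $(0,2)$). *)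

(* Defs.v *)
From HB Require Import structures.
From mathcomp Require Import all_boot all_order all_algebra.
From mathcomp Require Import all_classical all_reals all_analysis.
Set Implicit Arguments.
Unset Strict Implicit.
Unset Printing Implicit Defensive.
Import Order.TTheory GRing.Theory Num.Theory numFieldNormedType.Exports.
Local Open Scope classical_set_scope.
Local Open Scope ring_scope.

Section Plane.
Variable R : realType.
Implicit Types (X Y : R * R) (E : set (R * R)).

Definition dot X Y : R := X.1 * Y.1 + X.2 * Y.2.

(* The library norm on R * R is the sup norm, hence this Euclidean distance;
   both induce the product topology used for continuity below. *)
Definition dist X Y : R := Num.sqrt ((X.1 - Y.1) ^+ 2 + (X.2 - Y.2) ^+ 2).

Record circle := Circle {
  center : R * R;
  radius : R;
  radius_gt0 : 0 < radius }.

Definition circle_points (C : circle) : set (R * R) :=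
  [set X | dist X (center C) = radius C].

(* Two circles are orthogonal when they meet and their radii (equivalently,
   their tangent lines) are perpendicular at every common point. *)
Definition orthogonal_circles (C D : circle) : Prop :=
  circle_points C `&` circle_points D !=set0 /\
  forall X, circle_points C X -> circle_points D X ->
    dot (X - center C) (X - center D) = 0.

Definition elliptic_pencil (P Q : R * R) : set circle :=
  [set C | circle_points C P /\ circle_points C Q].

Definition hyperbolic_pencil (P Q : R * R) : set circle :=
  [set D | forall C, elliptic_pencil P Q C -> orthogonal_circles C D].

(* The value d = 0 (the perpendicular bisector of PQ) and the values
   |d| >= |PQ| (rays of the line PQ, or the empty set) do not give branches of
   hyperbolas; the sign of d selects the branch. *)
Definition hyperbola_branch (P Q : R * R) (H : set (R * R)) : Prop :=
  exists d : R, [/\ d != 0, `|d| < dist P Q &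
    H = [set X | dist X P - dist X Q = d]].

(* An arc of a curve E is a subset of E homeomorphic to a nondegenerate interval
   (open, half-open or closed, bounded or not); g is the inverse
   homeomorphism. In particular a whole circle is not an arc. *)
Definition arc_of E (A : set (R * R)) : Prop :=
  A `<=` E /\
  exists (I : set R) (f : R -> R * R) (g : R * R -> R),
    [/\ is_interval I, (exists a b, [/\ I a, I b & a < b]),
        f @` I = A, (forall u, I u -> g (f u) = u) &
        {within I, continuous f} /\ {within A, continuous g}].

Definition F1 : R * R := (-1, 0).
Definition F2 : R * R := (1, 0).

Definition quadrant : set (R * R) := [set X | 0 < X.1 /\ 0 < X.2].

Definition Omega : set (R * R) := [set X | 0 < X.1].

Definition phi (X : R * R) : R * R :=
  let: (x, y) := X in
  (expR x * Num.sqrt (1 + expR y) / (expR x + expR y),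
   expR y * Num.sqrt (expR x - 1) / (expR x + expR y)).

End Plane.

Arguments F1 {R}.
Arguments F2 {R}.
Arguments quadrant {R}.
Arguments Omega {R}.

(* Main.v *)
Require Import Defs.
From mathcomp Require Import all_boot all_order all_algebra.
From mathcomp Require Import all_classical all_reals all_analysis.
From mathcomp Require Import ring lra.
Set Implicit Arguments.
Unset Strict Implicit.
Unset Printing Implicit Defensive.
Import Order.TTheory GRing.Theory Num.Theory numFieldNormedType.Exports.
Local Open Scope classical_set_scope.
Local Open Scope ring_scope.

(** Put p = sqrt (1 + e^y) > 1 and q = sqrt (e^x - 1) > 0.  Identifying the
    plane with the complex numbers, phi (x, y) is (1 + ipq) / (p + iq), whose
    real and imaginary parts are rational in p and q ([phi_net]).  From this
    form one reads off three relations for (s, t) = phi (x, y):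
      s^2 + t^2 - 1 = t (q - 1/q),    a circle through F1 and F2 fixed by x;
      s^2 + t^2 + 1 = s (p + 1/p),    a circle of the hyperbolic pencil fixed
                                      by y;
      |XF1| - |XF2| = 2 sqrt mu,      mu = e^x / (e^x + e^y), fixed by x - y,
    the last one because |z + 1| and |z - 1| are (p + 1) and (p - 1) times the
    same factor |1 + iq| / |p + iq| = sqrt mu.

    Conversely, every point of the open quadrant lies on a circle of each of
    the first two families, since q - 1/q takes each real value for q > 0 and
    p + 1/p each value greater than 2 for p > 1; and two such circles meet in a
    single point of the quadrant ([pencils_meet_once]), which is therefore a
    value of phi.  Hence phi is onto.  As each point of the quadrant also
    determines the mu of its hyperbola ([confocal_unique]), the image of a line
    or ray x = k, y = k or x - y = k is the whole part in the quadrant of the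
    corresponding curve ([phi_vertical], [phi_horizontal], [phi_diagonal]).

    That part of the curve is the graph of the square root of a quadratic
    polynomial over an open interval of one of the coordinate axes:
      s = sqrt ((q - t) (t + 1/q))          for 0 < t < q,
      t = sqrt ((p - s) (s - 1/p))          for 1/p < s < p,
      s = sqrt (mu + mu / (1 - mu) * t^2)   for 0 < t.
    A graph over an interval is an arc: the coordinate projection is a
    continuous inverse of its parametrization ([arc_of_sqrt_graph1],
    [arc_of_sqrt_graph2]). *)

(** * The rational form of phi and the curves of the three families *)

(* The rewriting rules for phi need phi (x, y) unsplit into coordinates. *)
Local Arguments phi : simpl never.

(** The point (1 + ipq) / (p + iq) of the complex plane. *)
Definition net {R : realType} (p q : R) : R * R :=
  (p * (1 + q ^+ 2) / (p ^+ 2 + q ^+ 2), q * (p ^+ 2 - 1) / (p ^+ 2 + q ^+ 2)).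

(** For 0 < q, the circle through F1 and F2 whose highest point is (0, q); its
    center is (0, (q - q^-1) / 2) and its radius is (q + q^-1) / 2. *)
Definition elliptic_curve {R : realType} (q : R) : set (R * R) :=
  [set X | X.1 ^+ 2 + X.2 ^+ 2 - 1 = X.2 * (q - q^-1)].

(** The circle with diameter from (p^-1, 0) to (p, 0); its center and radius
    are ((p + p^-1) / 2, 0) and (p - p^-1) / 2 when 1 < p. *)
Definition hyperbolic_curve {R : realType} (p : R) : set (R * R) :=
  [set X | X.1 ^+ 2 + X.2 ^+ 2 + 1 = X.1 * (p + p^-1)].

(** For 0 < mu < 1, the hyperbola X.1^2 / mu - X.2^2 / (1 - mu) = 1 with foci
    F1 and F2, cleared of denominators. *)
Definition confocal_curve {R : realType} (mu : R) : set (R * R) :=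
  [set X | X.1 ^+ 2 * (1 - mu) - X.2 ^+ 2 * mu = mu * (1 - mu)].

Lemma sum_sqr_gt0 {R : realType} (p q : R) : 0 < q -> 0 < p ^+ 2 + q ^+ 2.
Proof. by move=> q0; rewrite ltr_wpDl ?sqr_ge0// exprn_gt0. Qed.

Lemma phi_net {R : realType} (x y : R) : 0 < x ->
  phi (x, y) = net (Num.sqrt (1 + expR y)) (Num.sqrt (expR x - 1)).
Proof.
move=> x0; have x1 : 1 < expR x by rewrite expR_gt1.
have y0 := expR_gt0 y.
rewrite /phi /net !sqr_sqrtr; [|lra..].
by congr pair; congr (_ / _); ring.
Qed.

Lemma net_phi {R : realType} (p q : R) : 1 < p -> 0 < q ->
  net p q = phi (ln (1 + q ^+ 2), ln (p ^+ 2 - 1)).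
Proof.
move=> p1 q0; have q2 : 0 < q ^+ 2 by rewrite exprn_gt0.
have p2 : 1 < p ^+ 2 by rewrite expr_gt1//; lra.
rewrite /phi !lnK ?posrE; [|lra..].
have -> : 1 + (p ^+ 2 - 1) = p ^+ 2 by ring.
have -> : 1 + q ^+ 2 - 1 = q ^+ 2 by ring.
rewrite !sqrtr_sqr !gtr0_norm//; last lra.
by rewrite /net; congr pair; congr (_ / _); ring.
Qed.

Lemma sqrt_expR_gt1 {R : realType} (y : R) : 1 < Num.sqrt (1 + expR y).
Proof. by rewrite -[X in X < _]sqrtr1 ltr_sqrt ?ltrDl ?addr_gt0 ?expR_gt0. Qed.

Lemma sqrt_expR_gt0 {R : realType} (x : R) : 0 < x -> 0 < Num.sqrt (expR x - 1).
Proof. by move=> x0; rewrite sqrtr_gt0 subr_gt0 expR_gt1. Qed.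

Lemma net_quadrant {R : realType} (p q : R) : 1 < p -> 0 < q ->
  quadrant (net p q).
Proof.
move=> p1 q0; have := sum_sqr_gt0 p q0 => D0.
have p2 : 1 < p ^+ 2 by rewrite expr_gt1//; lra.
have q2 : 0 < q ^+ 2 by rewrite exprn_gt0.
by split => /=; rewrite divr_gt0// mulr_gt0//; lra.
Qed.

Lemma net_elliptic {R : realType} (p q : R) :
  0 < q -> elliptic_curve q (net p q).
Proof.
move=> q0; rewrite /elliptic_curve /=; field.
by rewrite !gt_eqF// sum_sqr_gt0.
Qed.

Lemma net_hyperbolic {R : realType} (p q : R) : 1 < p -> 0 < q ->
  hyperbolic_curve p (net p q).
Proof.
move=> p1 q0; rewrite /hyperbolic_curve /=; field.
by rewrite !gt_eqF ?sum_sqr_gt0//; lra.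
Qed.

(** * Every point of the quadrant is a value of phi *)

(** The relation asks for p + p^-1 = 2d with 2 s d = s^2 + t^2 + 1, and d > 1
    off the x-axis because (s - 1)^2 + t^2 > 0; the larger root
    d + sqrt (d^2 - 1) is then a solution beyond 1. *)
Lemma quadrant_hyperbolic {R : realType} (X : R * R) : quadrant X ->
  exists2 p, 1 < p & hyperbolic_curve p X.
Proof.
case: X => s t [/= s0 t0].
pose d := (s ^+ 2 + t ^+ 2 + 1) / (2 * s).
have d1 : 1 < d.
  have t2 : 0 < t ^+ 2 by rewrite exprn_gt0.
  by rewrite /d ltr_pdivlMr ?mul1r ?mulr_gt0//; have := sqr_ge0 (s - 1); nra.
pose r := Num.sqrt (d ^+ 2 - 1).
have rE : r ^+ 2 = d ^+ 2 - 1 by rewrite sqr_sqrtr//; nra.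
have r0 : 0 <= r by exact: sqrtr_ge0.
exists (d + r); first lra.
rewrite /hyperbolic_curve /=.
have -> : (d + r)^-1 = d - r.
  apply: (@mulfI _ (d + r)); first by rewrite gt_eqF//; lra.
  by rewrite divff ?gt_eqF//; [ring: rE|lra].
have -> : d + r + (d - r) = d * 2 by ring.
by rewrite /d; field; rewrite gt_eqF.
Qed.

(** The positive root of q^2 - 2 c q - 1 is c + sqrt (c^2 + 1); the other root
    is minus its inverse. *)
Lemma sub_inv_surj {R : realType} (c : R) : exists2 q, 0 < q & q - q^-1 = 2 * c.
Proof.
pose r := Num.sqrt (c ^+ 2 + 1).
have rE : r ^+ 2 = c ^+ 2 + 1 by rewrite sqr_sqrtr//; nra.
have r0 : 0 <= r by exact: sqrtr_ge0.
have q0 : 0 < c + r by nra.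
exists (c + r) => //.
have -> : (c + r)^-1 = r - c.
  apply: (@mulfI _ (c + r)); first by rewrite gt_eqF.
  by rewrite divff ?gt_eqF//; ring: rE.
by ring.
Qed.

Lemma quadrant_elliptic {R : realType} (X : R * R) : quadrant X ->
  exists2 q, 0 < q & elliptic_curve q X.
Proof.
case: X => s t [/= s0 t0].
have [q q0 qE] := sub_inv_surj ((s ^+ 2 + t ^+ 2 - 1) / (2 * t)).
by exists q => //; rewrite /elliptic_curve /= qE; field; rewrite gt_eqF.
Qed.

(** With A = p + 1/p and B = q - 1/q, the difference of the two circle
    equations is the line s A = 2 + t B.  Eliminating s leaves a quadratic
    equation in t with constant term 4 - A^2 < 0, hence with a single positive
    root. *)
Lemma pencils_meet_once {R : realType} (p q : R) (X : R * R) :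
  1 < p -> 0 < q -> quadrant X ->
  elliptic_curve q X -> hyperbolic_curve p X -> X = net p q.
Proof.
move=> p1 q0 XQ XE XH.
have [u0 v0] := net_quadrant p1 q0.
have := net_elliptic p q0; have := net_hyperbolic p1 q0.
case: X XQ XE XH => s t [/= s0 t0].
case: (net p q) u0 v0 => u v /= u0 v0.
rewrite /elliptic_curve /hyperbolic_curve /=.
set A := p + p^-1; set B := q - q^-1 => Est Hst Huv Euv.
have A2 : 2 < A.
  have -> : A = 2 + (p - 1) ^+ 2 / p.
    by rewrite /A; field; rewrite gt_eqF//; lra.
  by rewrite ltrDl divr_gt0 ?exprn_gt0//; lra.
have sA : s * A = 2 + t * B by lra.
have uA : u * A = 2 + v * B by lra.
have tv : t = v.
  (* Eliminate the linear term between the quadratic equations of t and v: the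
     difference of v times the first and t times the second factors through
     t - v, with a positive cofactor. *)
  have : (t - v) * (t * v * (A ^+ 2 + B ^+ 2) + (A ^+ 2 - 4)) = 0.
    have Ft : (2 + t * B) ^+ 2 + A ^+ 2 * (t ^+ 2 - 1 - t * B) = 0.
      by rewrite -sA; have -> : t * B = s ^+ 2 + t ^+ 2 - 1 by []; ring.
    have Fv : (2 + v * B) ^+ 2 + A ^+ 2 * (v ^+ 2 - 1 - v * B) = 0.
      by rewrite -uA; have -> : v * B = u ^+ 2 + v ^+ 2 - 1 by []; ring.
    by rewrite -[RHS](subrr 0) -{1}(mulr0 v) -{1}Ft -(mulr0 t) -Fv; ring.
  move/eqP; rewrite mulf_eq0 subr_eq0 => /orP[/eqP//|].
  rewrite gt_eqF// addr_gt0//; last nra.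
  by rewrite !mulr_gt0// ltr_wpDr ?sqr_ge0// exprn_gt0//; lra.
congr pair => //; apply: (@mulIf _ A); first by rewrite gt_eqF//; lra.
by rewrite sA uA tv.
Qed.

Lemma phi_quadrant {R : realType} (X : R * R) : Omega X -> quadrant (phi X).
Proof.
case: X => x y /= x0; rewrite phi_net//.
exact: net_quadrant (sqrt_expR_gt1 y) (sqrt_expR_gt0 x0).
Qed.

Lemma ln1DX_gt0 {R : realType} (q : R) : 0 < q -> 0 < ln (1 + q ^+ 2).
Proof. by move=> q0; rewrite ln_gt0// ltrDl exprn_gt0. Qed.

Lemma phi_surj {R : realType} (X : R * R) : quadrant X ->
  exists2 Y, Omega Y & phi Y = X.
Proof.
move=> XQ; have [p p1 pX] := quadrant_hyperbolic XQ.
have [q q0 qX] := quadrant_elliptic XQ.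
exists (ln (1 + q ^+ 2), ln (p ^+ 2 - 1)); first exact: ln1DX_gt0.
by rewrite -net_phi//; exact/esym/pencils_meet_once.
Qed.

(** * Images of the lines and rays of the three families *)

Lemma phi_vertical {R : realType} (k : R) : 0 < k ->
  @phi R @` [set X | Omega X /\ X.1 = k] =
  quadrant `&` elliptic_curve (Num.sqrt (expR k - 1)).
Proof.
move=> k0; have q0 := sqrt_expR_gt0 k0.
have k1 : 1 < expR k by rewrite expR_gt1.
apply/seteqP; split => [_ [[x y] [/= x0 xk] <-]|X [XQ qX]].
  rewrite xk in x0 *; split; first exact: phi_quadrant.
  by rewrite phi_net//; exact: net_elliptic.
have [p p1 pX] := quadrant_hyperbolic XQ.
exists (k, ln (p ^+ 2 - 1)) => //.
rewrite (pencils_meet_once p1 q0 XQ qX pX) net_phi// sqr_sqrtr; last lra.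
have -> : 1 + (expR k - 1) = expR k by ring.
by rewrite expRK.
Qed.

Lemma phi_horizontal {R : realType} (k : R) :
  @phi R @` [set X | Omega X /\ X.2 = k] =
  quadrant `&` hyperbolic_curve (Num.sqrt (1 + expR k)).
Proof.
have p1 := sqrt_expR_gt1 k; have k0 := expR_gt0 k.
apply/seteqP; split => [_ [[x y] [/= x0 ->] <-]|X [XQ pX]].
  split; first exact: phi_quadrant.
  by rewrite phi_net//; exact/net_hyperbolic/sqrt_expR_gt0.
have [q q0 qX] := quadrant_elliptic XQ.
exists (ln (1 + q ^+ 2), k); first by split => //; exact: ln1DX_gt0.
rewrite (pencils_meet_once p1 q0 XQ qX pX) net_phi// sqr_sqrtr; last lra.
have -> : 1 + expR k - 1 = expR k by ring.
by rewrite expRK.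
Qed.

Lemma phi_confocal {R : realType} (x y : R) : 0 < x ->
  confocal_curve (expR x / (expR x + expR y)) (phi (x, y)).
Proof.
move=> x0; have x1 : 1 < expR x by rewrite expR_gt1.
have y0 := expR_gt0 y.
rewrite /confocal_curve /phi /= !exprMn !sqr_sqrtr; [|lra..].
by field; rewrite gt_eqF//; lra.
Qed.

(** For fixed (s, t) the equation of the curve is a monic quadratic in mu with
    product of roots s^2; two distinct roots mu, nu < 1 would give
    s^2 = mu nu < mu, whereas the equation itself gives mu < s^2. *)
Lemma confocal_unique {R : realType} (mu nu : R) (X : R * R) : quadrant X ->
  0 < mu < 1 -> 0 < nu < 1 -> confocal_curve mu X -> confocal_curve nu X ->
  mu = nu.
Proof.
case: X => s t [/= s0 t0] /andP[m0 m1] /andP[n0 n1].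
rewrite /confocal_curve /= => Em En.
have smu : mu < s ^+ 2.
  rewrite -(ltr_pM2r (_ : 0 < 1 - mu)); last lra.
  by rewrite -Em ltrBlDr ltrDl mulr_gt0// exprn_gt0.
have : (mu - nu) * (s ^+ 2 - mu * nu) = 0.
  have -> : (mu - nu) * (s ^+ 2 - mu * nu) =
     mu * (s ^+ 2 * (1 - nu) - t ^+ 2 * nu - nu * (1 - nu)) -
     nu * (s ^+ 2 * (1 - mu) - t ^+ 2 * mu - mu * (1 - mu)) by ring.
  by rewrite Em En !subrr !mulr0 subrr.
move/eqP; rewrite mulf_eq0 !subr_eq0 => /orP[/eqP//|/eqP mn].
by nra.
Qed.

Lemma expR_ratio_itv {R : realType} (x y : R) :
  0 < expR x / (expR x + expR y) < 1.
Proof.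
have x0 := expR_gt0 x; have y0 := expR_gt0 y.
by rewrite divr_gt0 ?addr_gt0//= ltr_pdivrMr ?addr_gt0// mul1r ltrDl.
Qed.

(** The parameter of the hyperbola depends on x - y only.  Keeping the shape
    e^x / (e^x + e^y), with (x - y, 0) for (x, y), lets the bounds on this ratio
    apply to both sides. *)
Lemma expR_ratioE {R : realType} (x y : R) :
  expR x / (expR x + expR y) = expR (x - y) / (expR (x - y) + expR 0).
Proof.
have x0 := expR_gt0 x; have y0 := expR_gt0 y.
rewrite expRD expRN expR0; field.
by rewrite !gt_eqF//; lra.
Qed.

Lemma expR_ratio_inj (R : realType) :
  injective (fun k : R => expR k / (expR k + expR 0)).
Proof.
move=> k l /eqP; have k0 := expR_gt0 k; have l0 := expR_gt0 l.
rewrite expR0 eqr_div; [|by rewrite gt_eqF//; lra..].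
by rewrite !mulrDr !mulr1 [expR l * _]mulrC => /eqP /addrI /expR_inj.
Qed.

Lemma phi_diagonal {R : realType} (k : R) :
  @phi R @` [set X | Omega X /\ X.1 - X.2 = k] =
  quadrant `&` confocal_curve (expR k / (expR k + expR 0)).
Proof.
apply/seteqP; split => [_ [[x y] [/= x0 <-] <-]|X [XQ kX]].
  split; first exact: phi_quadrant.
  by rewrite -expR_ratioE; exact: phi_confocal.
have [[x y] x0 XE] := phi_surj XQ.
exists (x, y) => //; split => //=; apply: expR_ratio_inj => /=.
apply: (confocal_unique XQ); rewrite ?expR_ratio_itv//.
by rewrite -expR_ratioE -XE; exact: phi_confocal.
Qed.

(** * Graphs over intervals are arcs *)

Lemma sqrt_poly_continuous {R : realType} (P : {poly R}) :
  continuous (fun u => Num.sqrt P.[u]).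
Proof.
move=> u; apply: continuous_comp; first exact: continuous_horner.
exact: sqrt_continuous.
Qed.

Lemma arc_of_sqrt_graph1 {R : realType} (E A : set (R * R)) (P : {poly R})
    (i : interval R) :
  A `<=` E -> (exists a b, [/\ [set` i] a, [set` i] b & a < b]) ->
  A = [set X | [set` i] X.1 /\ X.2 = Num.sqrt P.[X.1]] -> arc_of E A.
Proof.
move=> AE i2 AI; split => //.
pose h u := Num.sqrt P.[u].
have ch : continuous h by exact: sqrt_poly_continuous.
exists [set` i], (fun u => (u, h u)), fst; split => //.
- exact: interval_is_interval.
- rewrite AI; apply/seteqP; split => [_ [u ui <-]//|[u v] [/= ui ->]].
  by exists u.
- split; apply: continuous_subspaceT => u; last exact: cvg_fst.
  exact: (cvg_pair (G := nbhs u) (H := nbhs (h u)) cvg_id (ch u)).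
Qed.

Lemma arc_of_sqrt_graph2 {R : realType} (E A : set (R * R)) (P : {poly R})
    (i : interval R) :
  A `<=` E -> (exists a b, [/\ [set` i] a, [set` i] b & a < b]) ->
  A = [set X | [set` i] X.2 /\ X.1 = Num.sqrt P.[X.2]] -> arc_of E A.
Proof.
move=> AE i2 AI; split => //.
pose h u := Num.sqrt P.[u].
have ch : continuous h by exact: sqrt_poly_continuous.
exists [set` i], (fun u => (h u, u)), snd; split => //.
- exact: interval_is_interval.
- rewrite AI; apply/seteqP; split => [_ [u ui <-]//|[v u] [/= ui ->]].
  by exists u.
- split; apply: continuous_subspaceT => u; last exact: cvg_snd.
  exact: (cvg_pair (G := nbhs (h u)) (H := nbhs u) (ch u) cvg_id).
Qed.

(** * The two Apollonian pencils *)

Lemma circle_pointsP {R : realType} (C : circle R) (X : R * R) :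
  circle_points C X <->
  (X.1 - (Defs.center C).1) ^+ 2 + (X.2 - (Defs.center C).2) ^+ 2 =
  Defs.radius C ^+ 2.
Proof.
have r0 := radius_gt0 C; rewrite /circle_points /dist /=.
split => [<-|->]; first by rewrite sqr_sqrtr// addr_ge0 ?sqr_ge0.
by rewrite sqrtr_sqr gtr0_norm.
Qed.

Lemma elliptic_pencilP {R : realType} (C : circle R) :
  elliptic_pencil F1 F2 C <->
  (Defs.center C).1 = 0 /\ Defs.radius C ^+ 2 = 1 + (Defs.center C).2 ^+ 2.
Proof.
split => [[/circle_pointsP /= H1 /circle_pointsP /= H2]|[c0 rE]].
  have c0 : (Defs.center C).1 = 0 by lra.
  by split => //; rewrite -H1 c0; ring.
by split; apply/circle_pointsP; rewrite /= c0 rE; ring.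
Qed.

Lemma elliptic_pencil_center {R : realType} (b : R) :
  exists2 C, elliptic_pencil F1 F2 C & (Defs.center C).2 = b.
Proof.
have r0 : 0 < 1 + b ^+ 2 by rewrite ltr_pwDl ?sqr_ge0.
have r0' : 0 < Num.sqrt (1 + b ^+ 2) by rewrite sqrtr_gt0.
exists (Circle (0, b) r0') => //; apply/elliptic_pencilP; split => //=.
by rewrite sqr_sqrtr// ltW.
Qed.

Lemma elliptic_curve_circle {R : realType} (C : circle R) (q : R) :
  elliptic_pencil F1 F2 C -> q - q^-1 = 2 * (Defs.center C).2 ->
  elliptic_curve q `<=` circle_points C.
Proof.
move=> /elliptic_pencilP[c0 rE] qE X; rewrite /elliptic_curve /= qE => XE.
by apply/circle_pointsP; rewrite c0 rE; lra.
Qed.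

(** Any circle C of the elliptic pencil has a center (0, b) and squared radius
    1 + b^2, and the circle D below has a center (d, 0) and squared radius
    d^2 - 1.  The squared distance d^2 + b^2 of the centers is the sum of the
    squared radii, so the radii at a common point are perpendicular by the
    Pythagorean theorem.  A common point exists: it is [net p q] for the q
    that parametrizes C. *)
Lemma hyperbolic_pencil_curve {R : realType} (p : R) : 1 < p ->
  exists2 D, hyperbolic_pencil F1 F2 D &
    hyperbolic_curve p `<=` circle_points D.
Proof.
move=> p1; have p0 : 0 < p by lra.
have r0 : 0 < (p - p^-1) / 2.
  by rewrite divr_gt0// subr_gt0 (lt_trans _ p1)// invf_lt1.
pose D := Circle ((p + p^-1) / 2, 0) r0.
have dE : ((p + p^-1) / 2) ^+ 2 = 1 + ((p - p^-1) / 2) ^+ 2.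
  by field; rewrite gt_eqF.
have DP : hyperbolic_curve p `<=` circle_points D.
  move=> X; rewrite /hyperbolic_curve /= => XE.
  by apply/circle_pointsP => /=; lra.
exists D => // C CP; have [c0 rE] := (elliptic_pencilP C).1 CP.
split.
  have [q q0 qE] := sub_inv_surj (Defs.center C).2.
  exists (net p q); split; last exact/DP/net_hyperbolic.
  exact/(elliptic_curve_circle CP qE)/net_elliptic.
move=> X /circle_pointsP XC /circle_pointsP /= XD; move: XC XD.
by rewrite c0 rE /dot /= c0; lra.
Qed.

(** * The curves in the quadrant as graphs *)

Lemma gtr0_sqrtE {R : realType} (u v : R) :
  0 < u -> u ^+ 2 = v -> u = Num.sqrt v.
Proof. by move=> u0 <-; rewrite sqrtr_sqr gtr0_norm. Qed.

(** The equation of the circle factors as s^2 = (q - t) (t + 1/q), so that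
    0 < t forces t < q.  The projection on the first axis is not injective on
    this arc when 1 < q, hence the graph is over the second axis. *)
Lemma elliptic_graph {R : realType} (q : R) : 0 < q ->
  quadrant `&` elliptic_curve q =
  [set X | (X.2 \in `]0, q[) /\
    X.1 = Num.sqrt ((q%:P - 'X) * ('X + (q^-1)%:P)).[X.2]].
Proof.
move=> q0; have q0' : 0 < q^-1 by rewrite invr_gt0.
have qK : q * q^-1 = 1 by rewrite divff ?gt_eqF.
apply/seteqP; split => [[s t] [[/= s0 t0]]|[s t] /=].
  rewrite /elliptic_curve /= => E.
  have sE : s ^+ 2 = (q - t) * (t + q^-1) by lra.
  have s2 : 0 < s ^+ 2 by rewrite exprn_gt0.
  split; first by rewrite in_itv /= t0/=; move: s2; rewrite sE pmulr_lgt0; lra.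
  by rewrite !hornerE; exact: gtr0_sqrtE.
rewrite in_itv /= !hornerE => -[/andP[t0 tq] ->].
have v0 : 0 < (q - t) * (t + q^-1) by rewrite mulr_gt0; lra.
rewrite /elliptic_curve /= sqr_sqrtr ?ltW//; split; last lra.
by split => //=; rewrite sqrtr_gt0.
Qed.

(** The equation of the circle factors as t^2 = (p - s) (s - 1/p). *)
Lemma hyperbolic_graph {R : realType} (p : R) : 1 < p ->
  quadrant `&` hyperbolic_curve p =
  [set X | (X.1 \in `]p^-1, p[) /\
    X.2 = Num.sqrt ((p%:P - 'X) * ('X - (p^-1)%:P)).[X.1]].
Proof.
move=> p1; have p0' : 0 < p^-1 by rewrite invr_gt0; lra.
have pV1 : p^-1 < 1 by rewrite invf_lt1//; lra.
have pK : p * p^-1 = 1 by rewrite divff ?gt_eqF//; lra.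
apply/seteqP; split => [[s t] [[/= s0 t0]]|[s t] /=].
  rewrite /hyperbolic_curve /= => E.
  have tE : t ^+ 2 = (p - s) * (s - p^-1) by lra.
  have t2 : 0 < (p - s) * (s - p^-1) by rewrite -tE exprn_gt0.
  split; first by rewrite in_itv /=; apply/andP; split; nra.
  by rewrite !hornerE; exact: gtr0_sqrtE.
rewrite in_itv /= !hornerE => -[/andP[ps sp] ->].
have v0 : 0 < (p - s) * (s - p^-1) by rewrite mulr_gt0; lra.
rewrite /hyperbolic_curve /= sqr_sqrtr ?ltW//; split; last lra.
by split => /=; [lra|rewrite sqrtr_gt0].
Qed.

Lemma confocal_graph {R : realType} (mu : R) : 0 < mu < 1 ->
  quadrant `&` confocal_curve mu =
  [set X | (X.2 \in `]0, +oo[) /\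
    X.1 = Num.sqrt (mu%:P + (mu / (1 - mu))%:P * 'X^2).[X.2]].
Proof.
move=> /andP[m0 m1]; have c0 : 0 < mu / (1 - mu) by rewrite divr_gt0//; lra.
have vE t : (mu + mu / (1 - mu) * t ^+ 2) * (1 - mu) =
    mu * (1 - mu) + t ^+ 2 * mu.
  by field; rewrite gt_eqF//; lra.
apply/seteqP; split => [[s t] [[/= s0 t0]]|[s t] /=].
  rewrite /confocal_curve /= => E.
  split; first by rewrite in_itv /= t0.
  rewrite hornerD hornerCM hornerC hornerXn; apply: gtr0_sqrtE => //.
  apply: (@mulIf _ (1 - mu)); first by rewrite gt_eqF//; lra.
  by rewrite vE; lra.
rewrite in_itv /= andbT hornerD hornerCM hornerC hornerXn => -[t0 ->].
have v0 : 0 < mu + mu / (1 - mu) * t ^+ 2.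
  by rewrite addr_gt0// mulr_gt0// exprn_gt0.
rewrite /confocal_curve /= sqr_sqrtr ?ltW//; split.
  by split => //=; rewrite sqrtr_gt0.
by rewrite vE; lra.
Qed.

(** * Differences of focal distances *)

Lemma dist_net_F1 {R : realType} (p q : R) : 1 < p -> 0 < q ->
  dist (net p q) F1 = (p + 1) * Num.sqrt ((1 + q ^+ 2) / (p ^+ 2 + q ^+ 2)).
Proof.
move=> p1 q0; have D0 := sum_sqr_gt0 p q0.
rewrite -[p + 1]gtr0_norm ?addr_gt0//; last lra.
rewrite -sqrtr_sqr -sqrtrM ?sqr_ge0// /dist /=; congr Num.sqrt.
by field; rewrite gt_eqF.
Qed.

Lemma dist_net_F2 {R : realType} (p q : R) : 1 < p -> 0 < q ->
  dist (net p q) F2 = (p - 1) * Num.sqrt ((1 + q ^+ 2) / (p ^+ 2 + q ^+ 2)).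
Proof.
move=> p1 q0; have D0 := sum_sqr_gt0 p q0.
rewrite -[p - 1]gtr0_norm ?subr_gt0//.
rewrite -sqrtr_sqr -sqrtrM ?sqr_ge0// /dist /=; congr Num.sqrt.
by field; rewrite gt_eqF.
Qed.

Lemma phi_dist_sub {R : realType} (x y : R) : 0 < x ->
  dist (phi (x, y)) F1 - dist (phi (x, y)) F2 =
  2 * Num.sqrt (expR x / (expR x + expR y)).
Proof.
move=> x0; have x1 : 1 < expR x by rewrite expR_gt1.
have y0 := expR_gt0 y.
have p1 := sqrt_expR_gt1 y; have q0 := sqrt_expR_gt0 x0.
rewrite phi_net// dist_net_F1// dist_net_F2// -mulrBl !sqr_sqrtr; [|lra..].
congr (_ * Num.sqrt (_ / _)); ring.
Qed.

Lemma hyperbola_branch_foci {R : realType} (mu : R) : 0 < mu < 1 ->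
  hyperbola_branch F1 F2 [set X | dist X F1 - dist X F2 = 2 * Num.sqrt mu].
Proof.
move=> /andP[m0 m1]; have r0 : 0 < Num.sqrt mu by rewrite sqrtr_gt0.
exists (2 * Num.sqrt mu); split => //; first by rewrite gt_eqF// mulr_gt0.
rewrite gtr0_norm ?mulr_gt0// /dist /=.
have -> : (-1 - 1) ^+ 2 + (0 - 0) ^+ 2 = 2 ^+ 2 :> R by ring.
rewrite sqrtr_sqr gtr0_norm// -[ltRHS]mulr1 ltr_pM2l//.
by rewrite -[ltRHS]sqrtr1 ltr_sqrt.
Qed.

Unset Implicit Arguments.

Theorem theorem1 (R : realType) :
  [/\ set_fun Omega quadrant (@phi R),
      set_surj Omega quadrant (@phi R),
      forall k : R, 0 < k ->
        exists2 C : circle R, elliptic_pencil F1 F2 C &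
          arc_of (circle_points C) (@phi R @` [set X | Omega X /\ X.1 = k]),
      forall k : R,
        exists2 C : circle R, hyperbolic_pencil F1 F2 C &
          arc_of (circle_points C) (@phi R @` [set X | Omega X /\ X.2 = k]) &
      forall k : R,
        exists2 H : set (R * R), hyperbola_branch F1 F2 H &
          arc_of H (@phi R @` [set X | Omega X /\ X.1 - X.2 = k])].
Proof.
split.
- exact: phi_quadrant.
- by move=> X /phi_surj[Y YO YX]; exists Y.
- move=> k k0; have q0 := sqrt_expR_gt0 k0; set q := Num.sqrt _ in q0.
  have [C CP cE] := elliptic_pencil_center ((q - q^-1) / 2).
  exists C => //; rewrite phi_vertical// -/q.
  apply: (arc_of_sqrt_graph2 _ _ (elliptic_graph q0)).
  + move=> X [_]; apply: elliptic_curve_circle => //.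
    by rewrite cE; lra.
  + by exists (q / 3), (q / 2); rewrite /= !in_itv /=; split; lra.
- move=> k; have p1 := sqrt_expR_gt1 k; set p := Num.sqrt _ in p1.
  have [D DP pD] := hyperbolic_pencil_curve p1.
  exists D => //; rewrite phi_horizontal -/p.
  apply: (arc_of_sqrt_graph1 _ _ (hyperbolic_graph p1)).
  + by move=> X [_]; exact: pD.
  + have pV1 : p^-1 < 1 by rewrite invf_lt1//; lra.
    by exists 1, ((1 + p) / 2); rewrite /= !in_itv /=; split; lra.
- move=> k; have m01 := expR_ratio_itv k 0.
  exists [set X | dist X F1 - dist X F2 =
                  2 * Num.sqrt (expR k / (expR k + expR 0))].
    exact: hyperbola_branch_foci.
  have graphE := confocal_graph m01; rewrite -phi_diagonal in graphE.
  apply: (arc_of_sqrt_graph2 _ _ graphE).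
  + move=> _ [[x y] [/= x0 <-] <-].
    by rewrite phi_dist_sub// expR_ratioE.
  + by exists 1, 2; rewrite /= !in_itv /=; split; lra.
Qed.
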